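(* Let $n\ge2$. The only negative parts $\mathfrak g_{-2}\oplus\mathfrak g_{-1}$ of $|2|$-gradings $\mathfrak g_{-2}\oplus\cdots\oplus\mathfrak g_2$ of $\mathfrak g=\mathfrak{sl}(n+1,\mathbb R)$ which are $H$-type algebras with a positive definite scalar product are the Heisenberg algebras of dimension $2n-1$.
   Context: The $|2|$-gradings of $\mathfrak{sl}(n+1,\mathbb R)$ are, up to isomorphism, the gradings determined by $\Sigma_{i,j}=\{\alpha_i,\alpha_j\}$ with $1\le i\le[n/2]$, $i<j\le n+1-i$. Explicitly, with $E_{k\ell}$ the elementary matrices, $\mathfrak g_{-1}=\mathrm{span}\{E_{k\ell}: i<k\le j,\ 1\le\ell\le i\}\oplus\mathrm{span}\{E_{k\ell}: j<k\le n+1,\ i<\ell\le j\}$ and $\mathfrak g_{-2}=\mathrm{span}\{E_{k\ell}: j<k\le n+1,\ 1\le\ell\le i\}$, that is, the grading by block lower diagonals for the block sizes $i,\ j-i,\ n+1-j$. A real graded 2-step nilpotent Lie algebra $\mathfrak n=\mathfrak n_{-2}\oplus\mathfrak n_{-1}$ endowed with a positive definite scalar product $\langle\cdot,\cdot\rangle$ (for which $\mathfrak n_{-2}$ and $\mathfrak n_{-1}$ are orthogonal) is of $H$-type if the maps $J_z\in\mathrm{End}(\mathfrak n_{-1})$, $z\in\mathfrak n_{-2}$, defined by $\langle J_zx,y\rangle=\langle[x,y],z\rangle$ for $x,y\in\mathfrak n_{-1}$ satisfy $J_z^2=-\langle z,z\rangle\mathrm{Id}_{\mathfrak n_{-1}}$.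 Equivalently, for every $x\in\mathfrak n_{-1}$ with $\langle x,x\rangle=1$ the map $\mathrm{ad}_x:\ker(\mathrm{ad}_x)^\perp\to\mathfrak n_{-2}$ is a surjective isometry, where $\perp$ is the orthogonal complement in $\mathfrak n_{-1}$. *)

(* Defs.v *)
From HB Require Import structures.
From mathcomp Require Import all_boot all_order all_algebra.
From mathcomp Require Import reals ring.

Set Implicit Arguments.
Unset Strict Implicit.
Unset Printing Implicit Defensive.

Import Order.TTheory GRing.Theory Num.Theory.
Local Open Scope ring_scope.

Record lieAlg (K : fieldType) := LieAlg {
  lie_sort :> vectType K;
  lie : lie_sort -> lie_sort -> lie_sort;
  lieDZl : forall (a : K) (x y z : lie_sort),
    lie (a *: x + y) z = a *: lie x z + lie y z;
  lieDZr : forall (a : K) (x y z : lie_sort),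
    lie z (a *: x + y) = a *: lie z x + lie z y;
  liexx : forall x : lie_sort, lie x x = 0;
  lie_jacobi : forall x y z : lie_sort,
    lie x (lie y z) + lie y (lie z x) + lie z (lie x y) = 0
}.

Section LieSubspaces.

Context {K : fieldType} {L : lieAlg K}.

Definition lie_closed (U : {vspace L}) : Prop :=
  forall x y : L, x \in U -> y \in U -> lie x y \in U.

(* The last conjunct excludes abelian algebras (1-step nilpotent ones). *)
Definition graded_2step (n1 n2 : {vspace L}) : Prop :=
  [/\ directv (n2 + n1)%VS,
      forall x y : L, x \in n1 -> y \in n1 -> lie x y \in n2,
      forall x z : L, x \in (n2 + n1)%VS -> z \in n2 -> lie x z = 0
    & exists x y : L, [/\ x \in n1, y \in n1 & lie x y != 0]].

(* A |2|-grading of the Lie subalgebra S of L.  As usual for |k|-gradings, the *)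
(* extreme component is nonzero and the negative part is generated by the      *)
(* component of degree -1; the latter is stated as: every Lie subalgebra       *)
(* containing g (-1) contains the negative part.  The family g is indexed by   *)
(* all of int, and is zero outside of [-2, 2].                                 *)
Definition two_grading (S : {vspace L}) (g : int -> {vspace L}) : Prop :=
  [/\ directv (\sum_(k < 5) g (k%:Z - 2))%VS /\
        (\sum_(k < 5) g (k%:Z - 2))%VS = S,
      forall k : int, 2 < `|k| -> g k = 0%VS,
      forall (i j : int) (x y : L),
        x \in g i -> y \in g j -> lie x y \in g (i + j),
      forall H : {vspace L}, lie_closed H -> (g (-1)%R <= H)%VS ->
        (g (-2)%R + g (-1)%R <= H)%VS
    & g (-2)%R != 0%VS].

End LieSubspaces.

Definition graded_iso (K : fieldType) (L M : lieAlg K)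
    (n1 n2 : {vspace L}) (m1 m2 : {vspace M}) : Prop :=
  exists f : 'Hom(L, M),
    [/\ {in (n2 + n1)%VS &, injective f},
        (f @: n1)%VS = m1,
        (f @: n2)%VS = m2
      & forall x y : L, x \in (n2 + n1)%VS -> y \in (n2 + n1)%VS ->
          f (lie x y) = lie (f x) (f y)].

Section HType.

Context {R : realType} {L : lieAlg R}.

(* The values of ip outside of U are irrelevant. *)
Definition scalar_product (U : {vspace L}) (ip : L -> L -> R) : Prop :=
  [/\ forall (a : R) (x y z : L), x \in U -> y \in U -> z \in U ->
        ip (a *: x + y) z = a * ip x z + ip y z,
      forall x y : L, x \in U -> y \in U -> ip x y = ip y x
    & forall x : L, x \in U -> x != 0 -> 0 < ip x x].

(* An endomorphism of n1 is encoded as an endomorphism of the ambient space   *)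
(* preserving n1; since ip is nondegenerate on n1, the second condition        *)
(* determines J z on n1.                                                       *)
Definition H_type (n1 n2 : {vspace L}) (ip : L -> L -> R) : Prop :=
  [/\ graded_2step n1 n2,
      scalar_product (n2 + n1)%VS ip,
      forall z x : L, z \in n2 -> x \in n1 -> ip z x = 0
    & exists J : L -> 'End(L), forall z : L, z \in n2 ->
        [/\ (J z @: n1 <= n1)%VS,
            forall x y : L, x \in n1 -> y \in n1 ->
              ip (J z x) y = ip (lie x y) z
          & forall x : L, x \in n1 -> J z (J z x) = - ip z z *: x]].

End HType.

Section GeneralLinear.

Variables (K : fieldType) (N : nat).

Definition gl_lie (A B : 'M[K]_N) : 'M[K]_N := A *m B - B *m A.

Lemma gl_lieDZl (a : K) (A B C : 'M[K]_N) :
  gl_lie (a *: A + B) C = a *: gl_lie A C + gl_lie B C.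
Proof.
by rewrite /gl_lie mulmxDl mulmxDr -scalemxAl -scalemxAr scalerBr opprD addrACA.
Qed.

Lemma gl_lieDZr (a : K) (A B C : 'M[K]_N) :
  gl_lie C (a *: A + B) = a *: gl_lie C A + gl_lie C B.
Proof.
by rewrite /gl_lie mulmxDl mulmxDr -scalemxAl -scalemxAr scalerBr opprD addrACA.
Qed.

Lemma gl_liexx (A : 'M[K]_N) : gl_lie A A = 0.
Proof. exact: subrr. Qed.

Lemma gl_lie_jacobi (A B C : 'M[K]_N) :
  gl_lie A (gl_lie B C) + gl_lie B (gl_lie C A) + gl_lie C (gl_lie A B) = 0.
Proof.
rewrite /gl_lie !mulmxBl !mulmxBr !mulmxA.
by apply/matrixP => i j; rewrite !mxE; ring.
Qed.

Definition gl : lieAlg K :=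
  LieAlg gl_lieDZl gl_lieDZr gl_liexx gl_lie_jacobi.

Definition sl : {vspace gl} := lker (linfun (@mxtrace K N : 'M[K]_N -> K^o)).

Lemma mem_sl (A : gl) : (A \in sl) = (\tr (A : 'M[K]_N) == 0).
Proof. by rewrite memv_ker lfunE. Qed.

Lemma sl_closed : lie_closed sl.
Proof.
by move=> A B _ _; rewrite mem_sl /= /gl_lie linearB /= mxtrace_mulC subrr.
Qed.

End GeneralLinear.

Section Heisenberg.

Variables (K : fieldType) (m : nat).

Definition heis_space : vectType K := ('rV[K]_m * 'rV[K]_m * K^o)%type.

(* [(x, y, s), (x', y', t)] = (0, 0, x . y' - y . x') *)
Definition heis_lie (u v : heis_space) : heis_space :=
  (0, 0, (u.1.1 *m v.1.2^T) 0 0 - (u.1.2 *m v.1.1^T) 0 0).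

Lemma heis_lieDZl (a : K) (u v w : heis_space) :
  heis_lie (a *: u + v) w = a *: heis_lie u w + heis_lie v w.
Proof.
congr (_, _, _) => /=; rewrite ?scaler0 ?addr0 //.
rewrite !mulmxDl -!scalemxAl !mxE /GRing.scale /=; ring.
Qed.

Lemma heis_liexx (u : heis_space) : heis_lie u u = 0.
Proof.
congr (_, _, _) => /=; apply/eqP; rewrite subr_eq0; apply/eqP.
by rewrite -[in RHS](trmxK (u.1.2)) -trmx_mul [RHS]mxE.
Qed.

Lemma heis_lieDZr (a : K) (u v w : heis_space) :
  heis_lie w (a *: u + v) = a *: heis_lie w u + heis_lie w v.
Proof.
congr (_, _, _) => /=; rewrite ?scaler0 ?addr0 //.
rewrite !linearD !linearZ /= !mxE /GRing.scale /=; ring.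
Qed.

Lemma heis_lie_jacobi (u v w : heis_space) :
  heis_lie u (heis_lie v w) + heis_lie v (heis_lie w u)
    + heis_lie w (heis_lie u v) = 0.
Proof.
by congr (_, _, _); rewrite /= ?addr0 // !trmx0 !mulmx0 !mxE !subr0 !addr0.
Qed.

Definition heis : lieAlg K :=
  LieAlg heis_lieDZl heis_lieDZr heis_liexx heis_lie_jacobi.

Definition heis_1 : {vspace heis} :=
  lker (linfun (@snd ('rV[K]_m * 'rV[K]_m)%type K^o)).

Definition heis_2 : {vspace heis} :=
  lker (linfun (@fst ('rV[K]_m * 'rV[K]_m)%type K^o)).

Lemma mem_heis_1 (u : heis) : (u \in heis_1) = ((u : heis_space).2 == 0).
Proof. by rewrite memv_ker lfunE. Qed.

Lemma mem_heis_2 (u : heis) : (u \in heis_2) = ((u : heis_space).1 == 0).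
Proof. by rewrite memv_ker lfunE. Qed.

Lemma dim_heis : \dim {: heis} = (2 * m).+1.
Proof.
rewrite dimvf; transitivity (1 * m + 1 * m + 1)%N; first by [].
by rewrite !mul1n addn1 mul2n addnn.
Qed.

End Heisenberg.

(* The graded algebra n1 + n2 is isomorphic to the Heisenberg algebra of      *)
(* dimension d, the center being in degree -2.                                 *)
Definition heisenberg_of_dim (K : fieldType) (L : lieAlg K)
    (n1 n2 : {vspace L}) (d : nat) : Prop :=
  exists m : nat, \dim {: heis K m} = d /\
    graded_iso n1 n2 (heis_1 K m) (heis_2 K m).

(* Main.v *)
Require Import Defs.
From HB Require Import structures.
From mathcomp Require Import all_boot all_order all_algebra.
From mathcomp Require Import reals complex ring lra zify.
Import Order.TTheory GRing.Theory Num.Theory.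
Local Open Scope ring_scope.

Set Implicit Arguments.
Unset Strict Implicit.
Unset Printing Implicit Defensive.

(* The derivation acting by k on [g k] is inner, equal to [ad E].  Since
   [ad E] has its spectrum in {-2, ..., 2} and the eigenvalues of [ad E] are the
   differences of those of [E], the complex eigenvalues of [E] differ from their
   conjugates by integers, hence are real, and [E] is diagonalizable over R; so
   the grading is given by block diagonals in a suitable basis.  In an H-type
   algebra [ad x] maps [g (-1)] onto [g (-2)] for every x <> 0 of [g (-1)].
   Taking for x an elementary matrix in one of the two blocks of [g (-1)], the
   image consists of matrices with a single nonzero row (or column), which
   forces the two extreme blocks to have size 1: this is the Heisenberg
   algebra. *)

(** * Derivations and spectra of matrices *)

Lemma gl_lie_delta (F : fieldType) (N : nat) (x : 'M[F]_N) (i j : 'I_N) :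
  gl_lie x (delta_mx i j)
  = \sum_k (x k i *: delta_mx k j) - \sum_k (x j k *: delta_mx i k).
Proof.
apply/matrixP => a b; rewrite !mxE !summxE; congr (_ - _).
  rewrite (bigD1 i) //= mxE eqxx /= [RHS](bigD1 a) //= !mxE eqxx /=.
  by rewrite !big1 ?addr0 // => k /negbTE hk;
    rewrite !mxE ?[_ == k]eq_sym hk ?mulr0.
rewrite (bigD1 j) //= mxE eqxx andbT [RHS](bigD1 b) //= !mxE eqxx andbT mulrC.
by rewrite !big1 ?addr0 // => k /negbTE hk;
  rewrite !mxE ?[_ == k]eq_sym hk ?andbF ?mulr0 ?mul0r.
Qed.

Lemma mul_delta_mx_delta (F : fieldType) (N : nat) (y : 'M[F]_N) (i j k l : 'I_N) :
  delta_mx i j *m y *m delta_mx k l = y j k *: delta_mx i l.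
Proof.
rewrite -(mul_delta_mx (0 : 'I_1) i j) -(mul_delta_mx (0 : 'I_1) k l).
transitivity (delta_mx i (0 : 'I_1) *m (delta_mx (0 : 'I_1) j *m y *m delta_mx k (0 : 'I_1))
              *m delta_mx (0 : 'I_1) l); first by rewrite !mulmxA.
have -> : delta_mx 0 j *m y *m delta_mx k 0 = (y j k)%:M :> 'M_1.
  by rewrite -rowE -colE; apply/matrixP => a b; rewrite !mxE !ord1 eqxx.
by rewrite mul_mx_scalar -scalemxAl mul_delta_mx.
Qed.

(** The bases [delta_mx i j] and [delta_mx j i] are dual for the trace form, so the left side is the
    Casimir operator of gl in the adjoint representation. It acts on traceless matrices as the
    scalar [2 * N]. *)
Lemma casimir_gl (F : fieldType) (N : nat) (y : 'M[F]_N) :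
  \sum_i \sum_j gl_lie (delta_mx i j) (gl_lie (delta_mx j i) y)
  = (2 * N)%:R *: y - (2 * \tr y)%:M.
Proof.
have sum1 : \sum_i delta_mx i i = 1%:M :> 'M[F]_N by rewrite mx1_sum_delta.
under eq_bigr => i _ do under eq_bigr => j _ do
  rewrite /gl_lie mulmxBr mulmxBl !mulmxA mul_delta_mx -(mulmxA y) mul_delta_mx
    !mul_delta_mx_delta.
under eq_bigr => i _ do
  rewrite !sumrB sumr_const card_ord -scaler_suml -scaler_sumr sum1
    -mulmx_sumr sum1 mulmx1.
rewrite !sumrB sumr_const card_ord sumrMnl -mulmx_suml sum1 mul1mx.
rewrite -scaler_sumr -scaler_suml sum1 -/(mxtrace y) scalemx1 opprB addrACA.
rewrite -mulr2n -mulrnA mulnC scaler_nat mulr_natl raddfMn mulr2n opprD.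
by rewrite addrC.
Qed.

Lemma gl_lie_sumZl (F : fieldType) (N : nat) (I : finType) (c : I -> F) (A : I -> 'M[F]_N)
    (B : 'M[F]_N) :
  gl_lie (\sum_k c k *: A k) B = \sum_k c k *: gl_lie (A k) B.
Proof.
rewrite /gl_lie mulmx_suml mulmx_sumr -sumrB; apply: eq_bigr => k _.
by rewrite -scalemxAl -scalemxAr scalerBr.
Qed.

Lemma gl_lie_sumZr (F : fieldType) (N : nat) (I : finType) (c : I -> F) (A : I -> 'M[F]_N)
    (B : 'M[F]_N) :
  gl_lie B (\sum_k c k *: A k) = \sum_k c k *: gl_lie B (A k).
Proof.
rewrite /gl_lie mulmx_suml mulmx_sumr -sumrB; apply: eq_bigr => k _.
by rewrite -scalemxAl -scalemxAr scalerBr.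
Qed.

Lemma gl_lie_suml (F : fieldType) (N : nat) (I : finType) (A : I -> 'M[F]_N)
    (B : 'M[F]_N) :
  gl_lie (\sum_k A k) B = \sum_k gl_lie (A k) B.
Proof. by rewrite /gl_lie mulmx_suml mulmx_sumr -sumrB. Qed.

Lemma gl_lie_sumr (F : fieldType) (N : nat) (I : finType) (A : I -> 'M[F]_N)
    (B : 'M[F]_N) :
  gl_lie B (\sum_k A k) = \sum_k gl_lie B (A k).
Proof. by rewrite /gl_lie mulmx_suml mulmx_sumr -sumrB. Qed.

Lemma gl_lieBl (F : fieldType) (N : nat) (A B C : 'M[F]_N) :
  gl_lie (A - B) C = gl_lie A C - gl_lie B C.
Proof. by rewrite addrC -scaleN1r gl_lieDZl scaleN1r addrC. Qed.

Lemma gl_lieBr (F : fieldType) (N : nat) (A B C : 'M[F]_N) :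
  gl_lie C (A - B) = gl_lie C A - gl_lie C B.
Proof. by rewrite addrC -scaleN1r gl_lieDZr scaleN1r addrC. Qed.

Lemma gl_lieC (F : fieldType) (N : nat) (A B : 'M[F]_N) :
  gl_lie A B = - gl_lie B A.
Proof. by rewrite /gl_lie opprB. Qed.

Lemma gl_lie_leibniz (F : fieldType) (N : nat) (A B C : 'M[F]_N) :
  gl_lie A (gl_lie B C) = gl_lie (gl_lie A B) C + gl_lie B (gl_lie A C).
Proof.
rewrite /gl_lie !(mulmxBl, mulmxBr) !mulmxA.
by apply/matrixP => i j; rewrite !mxE; ring.
Qed.

Lemma gl_lieDr (F : fieldType) (N : nat) (A B C : 'M[F]_N) :
  gl_lie C (A + B) = gl_lie C A + gl_lie C B.
Proof. by rewrite -[A]scale1r gl_lieDZr !scale1r. Qed.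

Lemma gl_lieNr (F : fieldType) (N : nat) (A C : 'M[F]_N) :
  gl_lie C (- A) = - gl_lie C A.
Proof. by rewrite /gl_lie mulmxN mulNmx opprD. Qed.

(* The invariance of the Casimir element makes the vector
   [\sum_(i, j) [E_ij, D E_ji]] implement the derivation [2 N D], as in the
   proof of Whitehead's first lemma. *)
Lemma derivation_gl_inner (F : fieldType) (N : nat)
    (D : {linear 'M[F]_N -> 'M[F]_N}) :
  (2 * N)%:R != 0 :> F ->
  (forall x y, D (gl_lie x y) = gl_lie (D x) y + gl_lie x (D y)) ->
  (forall x, \tr (D x) = 0) ->
  exists E : 'M[F]_N, forall x, D x = gl_lie E x.
Proof.
move=> N2 derD trD.
have DB a b : D (a - b) = D a - D b by rewrite linearB.
have DS (c : 'I_N -> F) (A : 'I_N -> 'M[F]_N) :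
    D (\sum_k c k *: A k) = \sum_k c k *: D (A k).
  by rewrite linear_sum; apply: eq_bigr => k _; rewrite linearZ.
pose v := \sum_i \sum_j gl_lie (delta_mx i j) (D (delta_mx j i)).
have key x : gl_lie x v = (2 * N)%:R *: D x.
  (* Invariance of the tensor of dual bases under [ad x], with [D] applied to the second factor:
     expanded in elementary matrices, the triple sums cancel in pairs after renaming indices. *)
  have inv : \sum_i \sum_j (gl_lie (gl_lie x (delta_mx i j)) (D (delta_mx j i)) +
            gl_lie (delta_mx i j) (D (gl_lie x (delta_mx j i)))) = 0.
    under eq_bigr => i _ do under eq_bigr => j _ do
      rewrite !gl_lie_delta DB !DS gl_lieBl gl_lieBr
        !(gl_lie_sumZl, gl_lie_sumZr).
    under eq_bigr => i _ do rewrite big_split /= !sumrB.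
    rewrite big_split /= !sumrB addrACA -opprD [X in _ - X]addrC.
    have swap (G : 'I_N -> 'I_N -> 'I_N -> 'M[F]_N) :
        \sum_i \sum_j \sum_k G i j k = \sum_k \sum_j \sum_i G i j k.
      under eq_bigr => i _ do rewrite exchange_big.
      by rewrite exchange_big; apply: eq_bigr => k _; rewrite exchange_big.
    rewrite [X in X + _ - _]swap.
    have -> (G : 'I_N -> 'I_N -> 'I_N -> 'M[F]_N) :
        \sum_i \sum_j \sum_k G i j k = \sum_i \sum_k \sum_j G i j k.
      by under eq_bigr => i _ do rewrite exchange_big.
    under [X in _ - (_ + X)]eq_bigr => i _ do rewrite exchange_big.
    exact: subrr.
  (* By the Leibniz rule and the derivation property of [D], the two summands differ exactly by the
     summand of [inv]. *)
  have tot : \sum_i \sum_j (gl_lie x (gl_lie (delta_mx i j) (D (delta_mx j i))))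
     = \sum_i \sum_j gl_lie (delta_mx i j) (gl_lie (delta_mx j i) (D x)).
    apply: subr0_eq; rewrite -[RHS]inv -sumrB; apply: eq_bigr => i _.
    rewrite -sumrB; apply: eq_bigr => j _; rewrite derD.
    by rewrite gl_lie_leibniz gl_lieDr (gl_lieC (D x)) gl_lieNr -addrA
      [_ + gl_lie _ (gl_lie x _)]addrC.
  have -> : gl_lie x v =
     \sum_i \sum_j gl_lie x (gl_lie (delta_mx i j) (D (delta_mx j i))).
    rewrite /v /gl_lie mulmx_suml mulmx_sumr -sumrB; apply: eq_bigr => i _.
    by rewrite mulmx_suml mulmx_sumr -sumrB.
  by rewrite tot casimir_gl trD mulr0 raddf0 subr0.
(* The sign comes from [key], which has [v] as the second argument of the bracket. *)
exists (- (2 * N)%:R^-1 *: v) => x.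
have -> : gl_lie (- (2 * N)%:R^-1 *: v) x = (2 * N)%:R^-1 *: gl_lie x v.
  by rewrite scaleNr /gl_lie mulNmx mulmxN opprK -scalemxAl -scalemxAr scalerBr addrC.
by rewrite key scalerA mulVf // scale1r.
Qed.

(** * Spectrum of [ad E] and diagonalization over the base field *)

Definition ad_shift (F : fieldType) (N : nat) (E : 'M[F]_N) (c : F) (X : 'M[F]_N) :=
  gl_lie E X - c *: X.

(** The product of the operators [ad E - k] for [k] in [s], applied to [X]. Its vanishing for all
    [X] says that the polynomial with roots [s] annihilates [ad E]. *)
Definition ad_prod (F : fieldType) (N : nat) (E : 'M[F]_N) (s : seq F) (X : 'M[F]_N) :=
  foldr (ad_shift E) X s.

Lemma ad_prod_eigen (F : fieldType) (N : nat) (E X : 'M[F]_N) (s : seq F) (c : F) :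
  gl_lie E X = c *: X -> ad_prod E s X = (\prod_(k <- s) (c - k)) *: X.
Proof.
move=> EX; elim: s => [|k s IHs] /=; first by rewrite big_nil scale1r.
rewrite IHs big_cons /ad_shift -[_ *: X]addr0 gl_lieDZr EX.
rewrite {1}/gl_lie mulmx0 mul0mx subrr !addr0 !scalerA -scalerBl.
by congr (_ *: _); ring.
Qed.

Lemma ad_prodDZ (F : fieldType) (N : nat) (E : 'M[F]_N) (s : seq F) (a : F)
    (X Y : 'M[F]_N) :
  ad_prod E s (a *: X + Y) = a *: ad_prod E s X + ad_prod E s Y.
Proof.
elim: s => //= k s ->; rewrite /ad_shift gl_lieDZr.
by apply/matrixP => i j; rewrite !mxE; ring.
Qed.

Lemma ad_prod_map (F K : fieldType) (f : {rmorphism F -> K}) (N : nat)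
    (E X : 'M[F]_N) (s : seq F) :
  ad_prod (map_mx f E) (map f s) (map_mx f X) = map_mx f (ad_prod E s X).
Proof.
elim: s => //= k s ->; rewrite /ad_shift /gl_lie.
by rewrite !map_mxB !map_mxM map_mxZ.
Qed.

Lemma char_poly_tr (F : fieldType) (N : nat) (E : 'M[F]_N) :
  char_poly E^T = char_poly E.
Proof.
rewrite /char_poly -det_tr; congr (\det _).
by apply/matrixP => i j; rewrite !mxE eq_sym.
Qed.

(** If [v^T] is a column eigenvector for [a] and [w] a row eigenvector for [b], then the rank one
    matrix [v^T *m w] is an eigenvector of [ad E] for [a - b]. *)
Lemma ad_prod_spectrum (F : fieldType) (N : nat) (E : 'M[F]_N) (s : seq F) (a b : F) :
  (forall X, ad_prod E s X = 0) ->
  root (char_poly E) a -> root (char_poly E) b -> a - b \in s.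
Proof.
(* Library eigenvectors are rows, so the column eigenvector for [a] is obtained from the transpose
   of [E]. *)
move=> Es; rewrite -{1}char_poly_tr -!eigenvalue_root_char.
move=> /eigenvalueP[v Ev v0] /eigenvalueP[w Ew w0].
have Ev' : E *m v^T = a *: v^T by rewrite -[E]trmxK -trmx_mul Ev linearZ.
have X0 : v^T *m w != 0.
  have /rV0Pn[i vi] := v0; have /rV0Pn[j wj] := w0.
  apply: contra_neq (mulf_neq0 vi wj) => /matrixP/(_ i j).
  by rewrite !mxE big_ord1 !mxE.
have EX : gl_lie E (v^T *m w) = (a - b) *: (v^T *m w).
  by rewrite /gl_lie mulmxA Ev' -mulmxA Ew -scalemxAl -scalemxAr scalerBl.
have /eqP := ad_prod_eigen s EX; rewrite Es eq_sym scaler_eq0 (negbTE X0) orbF.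
rewrite prodf_seq_eq0 => /hasP[k ks]; rewrite /= subr_eq0.
by move=> /eqP ->.
Qed.
Import ComplexField.

(** A complex root [a] of the characteristic polynomial comes with its conjugate, and their
    difference lies in the real list [s]. Being purely imaginary, it is zero, so [a] is real. *)
Lemma ad_prod_real_root (R : rcfType) (N : nat) (E : 'M[R]_N.+1) (s : seq R) :
  (forall X, ad_prod E s X = 0) -> exists a, root (char_poly E) a.
Proof.
move=> Es; pose f := real_complex R.
pose EC := map_mx f E.
have ECs X : ad_prod EC (map f s) X = 0.
  (* Splitting into real and imaginary parts carries the annihilation of [ad E] over to complex
     matrices. *)
  have -> : X = 'i%C *: map_mx f (map_mx (@complex.Im R) X)
               + map_mx f (map_mx (@complex.Re R) X).
    by apply/matrixP => i j; rewrite !mxE addrC -complexE.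
  by rewrite ad_prodDZ !ad_prod_map !Es map_mx0 scaler0 addr0.
have charEC : char_poly EC = map_poly f (char_poly E) by rewrite map_char_poly.
have /closed_rootP[a ra] : size (char_poly EC) != 1%N by rewrite size_char_poly.
have ra' : root (char_poly EC) a^*%C.
  rewrite -complex_root_conj charEC -map_poly_comp /=.
  rewrite (eq_map_poly (g := f)) -?charEC // => x /=.
  exact: conjc_real.
have /mapP[k _] := ad_prod_spectrum ECs ra ra'.
case: a ra {ra'} => x y ra [] _ /= hy.
have y0 : y = 0 by lra.
by exists x; move: ra; rewrite y0 charEC (fmorph_root f).
Qed.

(** For a row eigenvector [w] of eigenvalue [a], [ad E] sends [v *m w] to [((E - a) v) *m w]. Hence
    the polynomial with simple roots [s] kills [E - a], which is therefore diagonalizable, and so is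
    [E]. *)
Lemma ad_prod_diag (F : fieldType) (N : nat) (E : 'M[F]_N.+1) (s : seq F) (a : F) :
  uniq s -> (forall X, ad_prod E s X = 0) -> root (char_poly E) a ->
  exists2 P, P \in unitmx &
    exists d : 'rV[F]_N.+1, E = invmx P *m diag_mx d *m P.
Proof.
move=> us Es; rewrite -eigenvalue_root_char => /eigenvalueP[w Ew w0].
have /rV0Pn[i wi] := w0.
have hor (v : 'cV[F]_N.+1) : ad_prod E s (v *m w) =
    horner_mx (E - a%:M) (\prod_(k <- s) ('X - k%:P)) *m v *m w.
  elim: (s) => [|k r IHr] /=; first by rewrite big_nil rmorph1 mul1mx.
  rewrite IHr big_cons rmorphM /= rmorphB /= horner_mx_X horner_mx_C.
  rewrite /ad_shift /gl_lie -(mulmxA _ w) Ew -scalemxAr -!mulmxA mulmxA.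
  set H := (X in E *m X); rewrite -!mul_scalar_mx.
  by rewrite -[RHS]/((E - a%:M - k%:M : 'M_N.+1) *m H) !mulmxBl.
have [P Pu Pd] : diagonalizable (E - a%:M).
  apply/diagonalizableP; exists s => //; apply: mxminpoly_min.
  (* Taking [v] a basis vector reads off column [k] of the polynomial in [E - a], up to the nonzero
     factor [w 0 i]. *)
  apply/matrixP => j k; have := hor (delta_mx k 0); rewrite Es -colE.
  move=> /matrixP/(_ j i) /eqP; rewrite !mxE big_ord1 !mxE eq_sym mulf_eq0.
  by rewrite (negbTE wi) orbF => /eqP.
have [d Ed] := (similar_diagLR Pu Pd).
exists P => //; exists (d + const_mx a).
rewrite conjumx ?unitmx_inv // invmxK in Ed.
have -> : diag_mx (d + const_mx a) = diag_mx d + a%:M.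
  by rewrite linearD /= diag_const_mx.
by rewrite mulmxDr mulmxDl -Ed mul_mx_scalar -scalemxAl mulVmx // scalemx1 subrK.
Qed.

Lemma ad_prod_diag_spectrum (F : fieldType) (N : nat) (P : 'M[F]_N) (d : 'rV[F]_N)
    (s : seq F) (i j : 'I_N) :
  P \in unitmx -> (forall X, ad_prod (invmx P *m diag_mx d *m P) s X = 0) ->
  d 0 i - d 0 j \in s.
Proof.
move=> Pu /ad_prod_spectrum Es.
suff ev k : root (char_poly (invmx P *m diag_mx d *m P)) (d 0 k) by apply: Es.
rewrite -eigenvalue_root_char; apply/eigenvalueP.
exists (delta_mx 0 k *m P).
  rewrite -!mulmxA (mulmxA P) mulmxV // mul1mx mulmxA scalemxAl; congr (_ *m P).
  apply/rowP => l; rewrite -rowE !mxE eqxx /=.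
  by case: eqVneq => [->|_]; rewrite ?mulr1 ?mulr0.
apply: contraTneq isT => /(congr1 (mulmx^~ (invmx P))).
rewrite mulmxK // mul0mx => /rowP/(_ k); rewrite !mxE !eqxx => /eqP.
by rewrite oner_eq0.
Qed.

(** * Gradings of sl are given by block diagonals *)

Section GradingOfSl.

Variables (R : rcfType) (n : nat).
Notation N := n.+1.
Implicit Types (X Y : 'M[R]_N) (g : int -> {vspace gl R N}).

Definition grade (k : 'I_5) : int := k%:Z - 2.

Definition grades : seq R := [seq (k%:Z - 2)%:~R | k <- iota 0 5].

Lemma grade_in (k : 'I_5) : (grade k)%:~R \in grades.
Proof. by rewrite /grades; apply/mapP; exists (k : nat); rewrite ?mem_iota ?ltn_ord. Qed.

Lemma uniq_grades : uniq grades.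
Proof. by rewrite map_inj_in_uniq // => i j _ _ /intr_inj /addIr []. Qed.

Lemma grade_onto (j : int) : `|j| <= 2 -> exists k, grade k = j.
Proof.
move=> hj; have h : (`|(j + 2)%R| < 5)%N by lia.
by exists (Ordinal h); rewrite /grade /=; lia.
Qed.

Lemma two_grading_trace g j X : two_grading (sl R N) g -> X \in g j -> \tr X = 0.
Proof.
move=> [[_ gsl] g0 _ _ _] Xj; apply/eqP; rewrite -mem_sl -gsl.
case: (leP `|j| 2) => [/grade_onto[k jk]|/g0 gj].
  by rewrite -jk in Xj; apply: subvP Xj; exact: (sumv_sup k).
by move: Xj; rewrite gj memv0 => /eqP ->; exact: mem0v.
Qed.

Lemma two_grading_decomp g X : two_grading (sl R N) g -> \tr X = 0 ->
  exists2 u : 'I_5 -> 'M[R]_N, forall k, u k \in g (grade k) & X = \sum_k u k.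
Proof.
move=> [[_ gsl] _ _ _ _] /eqP; rewrite -mem_sl -gsl => /memv_sumP[u ug ->].
by exists u => // k; apply: ug.
Qed.

Lemma two_grading_uniq g (u : 'I_5 -> 'M[R]_N) : two_grading (sl R N) g ->
  (forall k, u k \in g (grade k)) -> \sum_k u k = 0 -> forall k, u k = 0.
Proof.
move=> [[/directv_sum_independent dg _] _ _ _ _] ug u0 k.
by apply: (dg u) => // i _; apply: ug.
Qed.

(** The projection of gl onto sl along the scalar matrices. It extends a derivation of sl to gl,
    where [derivation_gl_inner] applies. *)
Definition traceless X := X - (\tr X / N%:R) *: 1%:M.

Lemma tr_traceless X : \tr (traceless X) = 0.
Proof.
by rewrite linearB linearZ /= mxtrace1 mulrVK ?subrr // unitfE pnatr_eq0.
Qed.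

Lemma traceless_id X : \tr X = 0 -> traceless X = X.
Proof. by rewrite /traceless => ->; rewrite mul0r scale0r subr0. Qed.

Lemma traceless_linear a X Y : traceless (a *: X + Y) = a *: traceless X + traceless Y.
Proof.
by apply/matrixP => i j; rewrite /traceless !mxE mxtraceD mxtraceZ; ring.
Qed.

Lemma gl_lie_traceless X Y : gl_lie (traceless X) (traceless Y) = gl_lie X Y.
Proof.
rewrite /gl_lie /traceless !(mulmxBl, mulmxBr) -!scalemxAl -!scalemxAr !mul1mx !mulmx1.
by apply/matrixP => i j; rewrite !mxE; ring.
Qed.

(** The derivation multiplying degree [k] by [k], extended by zero to scalar matrices, is a
    derivation of gl with traceless values, hence inner. *)
Lemma two_grading_inner g : two_grading (sl R N) g ->
  exists E : 'M[R]_N, forall j X, X \in g j -> gl_lie E X = j%:~R *: X.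
Proof.
move=> gg; have [[dg gsl] g0 glie _ _] := gg.
pose pk := sumv_pi_for (esym gsl).
pose D X : 'M[R]_N := \sum_k (grade k)%:~R *: (pk k (traceless X) : 'M[R]_N).
have Dlin : linear D.
  move=> a X Y; rewrite /D scaler_sumr -big_split; apply: eq_bigr => k _.
  rewrite traceless_linear linearP /=. 
  by rewrite scalerDr !scalerA mulrC.
pose DL : {linear 'M[R]_N -> 'M[R]_N} :=
  HB.pack D (GRing.isLinear.Build R 'M[R]_N 'M[R]_N _ D Dlin).
have DS (I : finType) (u : I -> 'M[R]_N) : D (\sum_i u i) = \sum_i D (u i).
  exact: (linear_sum DL).
have DE j X : X \in g j -> D X = j%:~R *: X.
  move=> Xj; rewrite /D traceless_id ?(two_grading_trace gg Xj) //.
  case: (leP `|j| 2) => [/grade_onto[k0 jk]|/g0 gj]; last first.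
    move: Xj; rewrite gj memv0 => /eqP ->.
    by rewrite scaler0 big1 // => k _; rewrite linear0 scaler0.
  have Xsl : X \in sl R N by rewrite mem_sl (two_grading_trace gg Xj).
  (* A homogeneous element is its own component, by uniqueness of the decomposition. *)
  have pkE k : pk k X = if k == k0 then X else 0.
    apply: subr0_eq; move: k.
    apply: (two_grading_uniq (u := fun k => pk k X - if k == k0 then X else 0) gg).
      move=> k; apply: memvB; first exact: memv_sum_pi.
      by case: eqP => [->|_]; rewrite ?jk // mem0v.
    by rewrite sumrB -big_mkcond big_pred1_eq (sumv_pi_sum (esym gsl)) ?subrr.
  under eq_bigr => k _ do rewrite pkE.
  rewrite (bigD1 k0) //= eqxx jk big1 ?addr0 // => k /negbTE ->.
  exact: scaler0.
have trD X : \tr (D X) = 0.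
  rewrite linear_sum big1 // => k _; rewrite linearZ /=.
  by rewrite (@two_grading_trace g (grade k)) ?mulr0 // memv_sum_pi.
have Dtl X : D (traceless X) = D X.
  by rewrite /D (traceless_id (tr_traceless X)).
(* Scalar matrices are central, so both sides depend only on traceless parts; bilinearity then
   reduces the identity to homogeneous elements. *)
have Dder X Y : D (gl_lie X Y) = gl_lie (D X) Y + gl_lie X (D Y).
  rewrite -(gl_lie_traceless X Y) -(gl_lie_traceless (D X)) -(gl_lie_traceless X (D Y)).
  rewrite !(traceless_id (trD _)) -(Dtl X) -(Dtl Y).
  have [u ug ->] := two_grading_decomp gg (tr_traceless X).
  have [v vg ->] := two_grading_decomp gg (tr_traceless Y).
  rewrite !DS !gl_lie_suml DS -big_split; apply: eq_bigr => i _.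
  rewrite !gl_lie_sumr DS -big_split; apply: eq_bigr => j _ /=.
  rewrite (DE _ _ (ug i)) (DE _ _ (vg j)) (DE (grade i + grade j)); last exact: glie.
  by rewrite rmorphD /= /gl_lie -!scalemxAl -!scalemxAr -!scalerBr scalerDl.
have [|E DE'] := @derivation_gl_inner _ _ DL _ Dder trD.
  by rewrite pnatr_eq0.
by exists E => j X /DE <-; rewrite -DE'.
Qed.

(** In the basis given by [P], nonzero entries occur only at positions of weight [c]. By
    [weight_mxP] this describes the eigenspaces of [ad] of a diagonalized matrix; the zero matrix
    has every weight. *)
Definition weight_mx (P : 'M[R]_N) (d : 'rV[R]_N) (c : R) X :=
  forall i j, (P *m X *m invmx P) i j != 0 -> d 0 i - d 0 j = c.

Lemma weight_mxP (P : 'M[R]_N) (d : 'rV[R]_N) c X : P \in unitmx ->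
  weight_mx P d c X <-> gl_lie (invmx P *m diag_mx d *m P) X = c *: X.
Proof.
move=> Pu; set E := invmx P *m _ *m P; pose Y := P *m X *m invmx P.
have XY : X = invmx P *m Y *m P by rewrite /Y !mulmxA mulVmx // mul1mx mulmxKV.
have EX : gl_lie E X - c *: X
    = invmx P *m (gl_lie (diag_mx d) Y - c *: Y) *m P.
  rewrite /gl_lie /E XY !(mulmxBl, mulmxBr) -!scalemxAr -!scalemxAl !mulmxA.
  by rewrite !(mulmxK Pu, mulmxKV Pu).
have ent i j : (gl_lie (diag_mx d) Y - c *: Y) i j = (d 0 i - d 0 j - c) * Y i j.
  by rewrite /gl_lie mul_diag_mx mul_mx_diag !mxE; ring.
have -> : (gl_lie E X = c *: X) <-> gl_lie (diag_mx d) Y - c *: Y = 0.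
  split=> [EXc|Y0]; last by apply: subr0_eq; rewrite EX Y0 mulmx0 mul0mx.
  move: EX; rewrite EXc subrr => /(congr1 (fun Z => P *m Z *m invmx P)).
  by rewrite mulmx0 mul0mx !mulmxA mulmxV // mul1mx mulmxK // => <-.
split=> [wX|Y0 i j Yij].
  apply/matrixP => i j; rewrite ent [RHS]mxE.
  case: (eqVneq (Y i j) 0) => [->|/wX ->]; first by rewrite mulr0.
  by rewrite subrr mul0r.
have /eqP := ent i j; rewrite Y0 [X in X == _]mxE eq_sym mulf_eq0 (negbTE Yij) orbF subr_eq0.
by move=> /eqP.
Qed.

(** Each homogeneous component is killed by its own factor of [ad_prod], so the element [E]
    implementing the grading is diagonalizable. Degree 0 is excluded because scalar matrices also
    commute with [E] without lying in sl. *)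
Lemma two_grading_weights g : two_grading (sl R N) g ->
  exists2 P, P \in unitmx & exists d : 'rV[R]_N,
    (forall i j, d 0 i - d 0 j \in grades) /\
    forall (k : int) X, k != 0 -> `|k| <= 2 -> X \in g k <-> weight_mx P d k%:~R X.
Proof.
move=> gg; have [E gE] := two_grading_inner gg.
have Es X : ad_prod E grades X = 0.
  rewrite -[X](subrK ((\tr X / N%:R) *: 1%:M)) addrC ad_prodDZ -/(traceless X).
  have [u ug ->] := two_grading_decomp gg (tr_traceless X).
  have ad0 Y c : c \in grades -> gl_lie E Y = c *: Y -> ad_prod E grades Y = 0.
    move=> cg /ad_prod_eigen ->; apply/eqP; rewrite scaler_eq0 prodf_seq_eq0.
    by apply/orP; left; apply/hasP; exists c; rewrite //= subrr.
  (* The scalar part is killed by the factor of degree 0, which has index 2 in ['I_5]. *)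
  rewrite (ad0 1%:M 0); first last.
  - by rewrite /gl_lie mulmx1 mul1mx subrr scale0r.
  - by have := grade_in (inord 2); rewrite /grade inordK // subrr.
  rewrite scaler0 add0r; elim/big_ind: _ => [|Y Z Y0 Z0|k _].
  - by apply: (ad0 0 _ (grade_in 0)); rewrite /gl_lie mulmx0 mul0mx subrr scaler0.
  - by rewrite -[Y]scale1r ad_prodDZ Y0 Z0 scaler0 addr0.
  - exact: ad0 (grade_in k) (gE _ _ (ug k)).
have [a ra] := ad_prod_real_root Es.
have [P Pu [d Ed]] := ad_prod_diag uniq_grades Es ra.
exists P => //; exists d; split.
  by move=> i j; apply: (@ad_prod_diag_spectrum _ _ P d grades i j Pu) => X; rewrite -Ed.
move=> k X k0 k2; rewrite weight_mxP // -Ed; split; first exact: gE.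
(* An eigenvector of [ad E] for a nonzero eigenvalue is a multiple of a commutator, hence traceless
   and decomposable in the grading. *)
move=> EX; have trX : \tr X = 0.
  have /eqP : k%:~R * \tr X = 0.
    by rewrite -mxtraceZ -EX linearB /= mxtrace_mulC subrr.
  by rewrite mulf_eq0 intr_eq0 (negbTE k0) => /eqP.
have [u ug Xu] := two_grading_decomp gg trX.
have [l lk] := grade_onto k2.
(* Apply [ad E - k] to the decomposition of [X]: by uniqueness every component is killed, so only
   the one of degree [k] survives. *)
have u0 i : ((grade i)%:~R - k%:~R) *: u i = 0.
  pose w i := ((grade i)%:~R - k%:~R) *: u i.
  apply: (@two_grading_uniq g w gg _ _ i).
    by move=> j; apply: memvZ; exact: ug.
  have wE j : w j = gl_lie E (u j) - k%:~R *: u j.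
    by rewrite (gE _ _ (ug j)) -scalerBl.
  under eq_bigr => j _ do rewrite wE.
  by rewrite sumrB -gl_lie_sumr -scaler_sumr -Xu EX subrr.
have := ug l; rewrite lk; suff <- : X = u l.
  by [].
rewrite Xu (bigD1 l) //= big1 ?addr0 // => i il; apply/eqP.
have /eqP := u0 i; rewrite scaler_eq0 subr_eq0 eqr_int -lk => /orP[|//].
by move=> /eqP /addIr [] /val_inj ii; rewrite ii eqxx in il.
Qed.

End GradingOfSl.

(** * H-type algebras *)

Section HTypeAlgebras.

Variables (R : realType) (L : lieAlg R) (n1 n2 : {vspace L}) (ip : L -> L -> R).
Hypothesis Hip : H_type n1 n2 ip.
Notation U := (n2 + n1)%VS.

Lemma sub_n1 : (n1 <= U)%VS. Proof. exact: addvSr. Qed.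
Lemma sub_n2 : (n2 <= U)%VS. Proof. exact: addvSl. Qed.

Lemma lie0l (x : L) : lie 0 x = 0.
Proof.
by have := lieDZl (-1) 0 0 x; rewrite scaler0 addr0 scaleN1r addNr.
Qed.

Lemma lie0r (x : L) : lie x 0 = 0.
Proof.
by have := lieDZr (-1) 0 0 x; rewrite scaler0 addr0 scaleN1r addNr.
Qed.

Lemma lieZr (a : R) (x y : L) : lie x (a *: y) = a *: lie x y.
Proof. by rewrite -[a *: y]addr0 lieDZr lie0r addr0. Qed.

Lemma lie_anti (x y : L) : lie y x = - lie x y.
Proof.
have := lieDZl 1 x y (x + y).
have := lieDZr 1 x y x; have := lieDZr 1 x y y.
rewrite !scale1r !liexx addr0 add0r => -> -> /esym/eqP.
by rewrite addrC addr_eq0 => /eqP.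
Qed.

Lemma ipC (x y : L) : x \in U -> y \in U -> ip x y = ip y x.
Proof. by case: Hip => _ [_ sym _] _ _; exact: sym. Qed.

Lemma ipDZl (a : R) (x y z : L) : x \in U -> y \in U -> z \in U ->
  ip (a *: x + y) z = a * ip x z + ip y z.
Proof. by case: Hip => _ [lin _ _] _ _; exact: lin. Qed.

Lemma ip0l (z : L) : z \in U -> ip 0 z = 0.
Proof.
move=> zU; have := ipDZl (-1) zU zU zU.
by rewrite scaleN1r addNr mulN1r addNr.
Qed.

Lemma ipDl (x y z : L) : x \in U -> y \in U -> z \in U ->
  ip (x + y) z = ip x z + ip y z.
Proof. by move=> xU yU zU; rewrite -[x in LHS]scale1r ipDZl // mul1r. Qed.

Lemma ipZl (a : R) (x z : L) : x \in U -> z \in U -> ip (a *: x) z = a * ip x z.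
Proof.
by move=> xU zU; rewrite -[a *: x]addr0 ipDZl ?mem0v // ip0l // addr0.
Qed.

Lemma ip_nondeg (V : {vspace L}) (x y : L) : (V <= U)%VS -> x \in V -> y \in V ->
  (forall z, z \in V -> ip x z = ip y z) -> x = y.
Proof.
move=> VU xV yV xy; apply: subr0_eq; apply/eqP; apply: contraT => xy0.
have dV : x - y \in V by apply: memvB.
have : 0 < ip (x - y) (x - y).
  by case: Hip => _ [_ _ pos] _ _; apply: pos => //; apply: (subvP VU).
have [xU yU dU] : [/\ x \in U, y \in U & x - y \in U] by split; apply: (subvP VU).
have := ipDZl (-1) yU xU dU; rewrite scaleN1r [- y + x]addrC => ->.
by rewrite xy // mulN1r addNr ltxx.
Qed.

(* Polarizing [J_z ^ 2 = - <z, z>] gives [[x, J_z x] = <x, x> z]. *)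
Lemma H_type_ad_onto (x z : L) : x \in n1 -> x != 0 -> z \in n2 ->
  exists2 y, y \in n1 & lie x y = z.
Proof.
move=> x1 x0; have [[_ br11 _ _] [_ _ pos] orth [J HJ]] := Hip.
have m1 := subvP sub_n1; have m2 := subvP sub_n2.
have J1 w y : w \in n2 -> y \in n1 -> J w y \in n1.
  by move=> /HJ[Jn _ _] y1; apply: (subvP Jn); apply: memv_img.
have Jip w y t : w \in n2 -> y \in n1 -> t \in n1 -> ip (J w y) t = ip (lie y t) w.
  by move=> /HJ[_ Jw _]; exact: Jw.
have skew w y t : w \in n2 -> y \in n1 -> t \in n1 -> ip (J w y) t = - ip y (J w t).
  move=> w2 y1 t1; rewrite [in RHS]ipC ?m1 ?J1 // !Jip // (lie_anti y t).
  by rewrite -[- lie y t]scaleN1r ipZl ?m2 ?br11 // mulN1r opprK.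
have norm w : w \in n2 -> ip (J w x) (J w x) = ip w w * ip x x.
  move=> w2; rewrite skew ?J1 //; have [_ _ ->] := HJ _ w2; last by [].
  by rewrite ipC ?m1 ?memvZ // ipZl ?m1 // mulNr opprK.
(* [J] is given merely as a function of [z]; additivity at [x] follows from its defining identity
   and nondegeneracy on [n1]. *)
have JD w t : w \in n2 -> t \in n2 -> J (w + t) x = J w x + J t x.
  move=> w2 t2; apply: (ip_nondeg sub_n1); rewrite ?J1 ?memvD ?J1 // => y y1.
  have xyU : lie x y \in U by rewrite m2 ?br11.
  rewrite ipDl ?m1 ?J1 // !Jip ?memvD //.
  have sym s : s \in n2 -> ip (lie x y) s = ip s (lie x y).
    by move=> s2; apply: ipC => //; exact: m2.
  by rewrite !sym ?memvD // ipDl //; apply: m2.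
have polar w t : w \in n2 -> t \in n2 -> ip (J w x) (J t x) = ip w t * ip x x.
  move=> w2 t2; have wt2 : w + t \in n2 by apply: memvD.
  have := norm _ wt2; rewrite JD //.
  have [a1 b1] : J w x \in n1 /\ J t x \in n1 by rewrite !J1.
  have [aU bU] : J w x \in U /\ J t x \in U by rewrite !m1.
  have [wU tU] : w \in U /\ t \in U by rewrite !m2.
  rewrite !ipDl ?memvD // ![ip _ (_ + _)]ipC ?memvD // !ipDl // !norm //.
  rewrite (ipC bU aU) (ipC tU wU) => h; lra.
(* The preimage of [z] is [J z x] divided by the square norm of [x]. *)
move=> z2; exists ((ip x x)^-1 *: J z x); first by rewrite memvZ ?J1.
have xx : ip x x != 0 by rewrite gt_eqF ?pos ?m1.
suff lieJ : lie x (J z x) = ip x x *: z by rewrite lieZr lieJ scalerA mulVf ?scale1r.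
apply: (ip_nondeg sub_n2); rewrite ?memvZ ?br11 ?J1 // => w w2.
by rewrite -Jip ?J1 // polar // ipZl ?m2 // mulrC ipC ?m2.
Qed.

End HTypeAlgebras.

(** * Weights of an H-type negative part *)

Lemma gradesE (R : rcfType) (c : R) :
  c \in grades R -> c = -2 \/ c = -1 \/ c = 0 \/ c = 1 \/ c = 2.
Proof.
rewrite /grades /= !inE => /or4P[|||/orP[]] /eqP ->.
- by left; ring.
- by right; left; ring.
- by do 2!right; left; ring.
- by do 3!right; left; ring.
- by do 4!right; ring.
Qed.

Section WeightsOfHType.

Variables (R : realType) (n : nat) (P : 'M[R]_n.+1) (d : 'rV[R]_n.+1).
Hypothesis Pu : P \in unitmx.

(** The elementary matrices of the basis that diagonalizes the grading element. *)
Definition conj_delta (a b : 'I_n.+1) : 'M[R]_n.+1 := invmx P *m delta_mx a b *m P.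

Lemma conj_conj_delta a b : P *m conj_delta a b *m invmx P = delta_mx a b.
Proof. by rewrite /conj_delta !mulmxA mulmxV // mul1mx mulmxK. Qed.

Lemma weight_conj_delta a b c : d 0 a - d 0 b = c -> weight_mx P d c (conj_delta a b).
Proof.
move=> dab i j; rewrite conj_conj_delta !mxE.
by rewrite pnatr_eq0 eqb0 negbK => /andP[/eqP-> /eqP->].
Qed.

Lemma conj_delta_neq0 a b : conj_delta a b != 0.
Proof.
apply/eqP => ab0; have := conj_conj_delta a b; rewrite ab0 mulmx0 mul0mx.
by move=> /matrixP/(_ a b)/eqP; rewrite !mxE !eqxx eq_sym oner_eq0.
Qed.

Lemma neq0_weights c (X : 'M[R]_n.+1) : X != 0 -> weight_mx P d c X ->
  exists a b, d 0 a - d 0 b = c.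
Proof.
move=> X0 wX; have : P *m X *m invmx P != 0.
  apply: contraNneq X0 => /(congr1 (fun Z => invmx P *m Z *m P)).
  by rewrite !mulmxA mulVmx // mul1mx mulmxKV // mulmx0 mul0mx => ->.
case/matrix0Pn=> a [b Yab]; exists a, b; exact: wX.
Qed.

(** In the adapted basis, a bracket with the elementary matrix at [(a, b)] is supported on row [a]
    and column [b], so its entry at [(a', b')] vanishes. *)
Lemma lie_conj_delta_neq a b a' b' (Y : 'M[R]_n.+1) : a != a' -> b != b' ->
  gl_lie (conj_delta a b) Y != conj_delta a' b'.
Proof.
move=> aa' bb'; apply/eqP => /(congr1 (fun Z => P *m Z *m invmx P)).
rewrite conj_conj_delta /gl_lie mulmxBr mulmxBl.
have -> : P *m (conj_delta a b *m Y) *m invmx P = delta_mx a b *m (P *m Y *m invmx P).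
  by rewrite -conj_conj_delta !mulmxA mulmxKV.
have -> : P *m (Y *m conj_delta a b) *m invmx P = (P *m Y *m invmx P) *m delta_mx a b.
  by rewrite -conj_conj_delta !mulmxA mulmxKV.
move=> /matrixP/(_ a' b')/eqP; rewrite !mxE !big1 ?eqxx ?subrr ?[_ == 1]eq_sym ?oner_eq0 //.
  by move=> k _; rewrite [delta_mx _ _ _ _]mxE [b' == _]eq_sym (negbTE bb') andbF mulr0.
by move=> k _; rewrite [delta_mx _ _ _ _]mxE [a' == _]eq_sym (negbTE aa') mul0r.
Qed.

(** The values of [d] form three levels. A second index on an extreme level would give an elementary
    matrix of [n2] outside the image of [ad] of some elementary matrix of [n1], against
    [H_type_ad_onto]. *)
Lemma H_type_weights (n1 n2 : {vspace gl R n.+1}) ip :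
  (forall i j, d 0 i - d 0 j \in grades R) ->
  (forall X : 'M[R]_n.+1, X \in n1 <-> weight_mx P d (-1) X) ->
  (forall X : 'M[R]_n.+1, X \in n2 <-> weight_mx P d (-2) X) ->
  H_type n1 n2 ip ->
  exists i0 j0, d 0 j0 = d 0 i0 + 2 /\
    forall a, a != i0 -> a != j0 -> d 0 a = d 0 i0 + 1.
Proof.
move=> dg n1E n2E H; have [[_ br11 _ [x [y [x1 y1 xy0]]]] _ _ _] := H.
have [i0 [j0 ij]] := neq0_weights xy0 ((n2E _).1 (br11 _ _ x1 y1)).
have x0 : x != 0 by apply: contraNneq xy0 => ->; rewrite lie0l.
have [a1 [b1 ab1]] := neq0_weights x0 ((n1E _).1 x1).
(* The differences of [d 0 a] with both extremes [d 0 i0] and [d 0 j0], which are 2 apart, must be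
   integers between -2 and 2. *)
have tri a : [\/ d 0 a = d 0 i0, d 0 a = d 0 i0 + 1 | d 0 a = d 0 i0 + 2].
  case: (gradesE (dg a j0)) => [|[|[|[]]]] h; case: (gradesE (dg i0 a)) => [|[|[|[]]]] h';
  first [apply: Or31; lra | apply: Or32; lra | apply: Or33; lra].
(* A nonzero entry of weight -1 joins two consecutive levels, so one of its two indices is on the
   middle level. *)
have [m dm] : exists m, d 0 m = d 0 i0 + 1.
  case: (tri a1) => [ha|ha|ha]; first (by exists b1; lra); first by exists a1.
  by case: (tri b1) => hb; lra.
have onto := H_type_ad_onto H.
exists i0, j0; split=> [|a ai aj]; first lra.
case: (tri a) => // da; exfalso.
(* A second index [a] on the lowest level: brackets with the matrix at [(i0, m)] miss position
   [(a, j0)]. *)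
- have [||z _ /eqP] := onto (conj_delta i0 m) (conj_delta a j0) _ (conj_delta_neq0 _ _).
  + by apply/n1E/weight_conj_delta; lra.
  + by apply/n2E/weight_conj_delta; lra.
  apply/negP; apply: lie_conj_delta_neq; first by rewrite eq_sym.
  by apply/eqP => mj; move: dm ij; rewrite mj; lra.
(* A second index [a] on the highest level: brackets with the matrix at [(m, j0)] miss position
   [(i0, a)]. *)
- have [||z _ /eqP] := onto (conj_delta m j0) (conj_delta i0 a) _ (conj_delta_neq0 _ _).
  + by apply/n1E/weight_conj_delta; lra.
  + by apply/n2E/weight_conj_delta; lra.
  apply/negP; apply: lie_conj_delta_neq; last by rewrite eq_sym.
  by apply/eqP => mj; move: dm; rewrite mj; lra.
Qed.

End WeightsOfHType.

(** * Isomorphism with the Heisenberg algebra when the extreme blocks have size 1 *)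

Section WeightsToHeisenberg.

Variables (R : realType) (m : nat) (P : 'M[R]_m.+2) (d : 'rV[R]_m.+2).
Variables (i0 : 'I_m.+2) (k0 : 'I_m.+1).
Let j0 := lift i0 k0.
Let s (t : 'I_m) := lift i0 (lift k0 t).
Hypothesis Pu : P \in unitmx.
Hypothesis d_max : d 0 j0 = d 0 i0 + 2.
Hypothesis d_mid : forall t, d 0 (s t) = d 0 i0 + 1.

Lemma heis_index (Q : 'I_m.+2 -> Prop) :
  Q i0 -> Q j0 -> (forall t, Q (s t)) -> forall a, Q a.
Proof.
move=> Qi Qj Qs a; case: (unliftP i0 a) => [k ->|-> //].
by case: (unliftP k0 k) => [t ->|->] //; exact: Qs.
Qed.

Let conjP (X : 'M[R]_m.+2) := P *m X *m invmx P.

(** The negative part lives in row [i0] and column [j0]. The middle indices, enumerated by [s], give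
    the two vector coordinates, and the corner gives the central one. *)
Definition to_heis (X : 'M[R]_m.+2) : heis_space R m :=
  (\row_t conjP X i0 (s t), \row_t conjP X (s t) j0, conjP X i0 j0).

Lemma to_heis_linear : linear to_heis.
Proof.
move=> a X Y; have E i j : conjP (a *: X + Y) i j = a * conjP X i j + conjP Y i j.
  by rewrite /conjP mulmxDr mulmxDl -scalemxAr -scalemxAl !mxE.
rewrite /to_heis E; congr (_, _, _);
  by apply/rowP => t; rewrite [LHS]mxE E !mxE.
Qed.

HB.instance Definition _ :=
  GRing.isLinear.Build R 'M[R]_m.+2 (heis_space R m) _ to_heis to_heis_linear.

(** A right inverse of [to_heis] with values in the negative part, which yields surjectivity. *)
Definition of_heis (u : heis_space R m) : 'M[R]_m.+2 :=
  \sum_t (u.1.1 0 t *: conj_delta P i0 (s t) + u.1.2 0 t *: conj_delta P (s t) j0)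
  + u.2 *: conj_delta P i0 j0.

Lemma heis_index_eq :
  ((i0 == j0 = false) * (j0 == i0 = false) *
   ((forall t, i0 == s t = false) * (forall t, s t == i0 = false)) *
   ((forall t, j0 == s t = false) * (forall t, s t == j0 = false)) *
   (forall t t', (s t == s t') = (t == t')))%type.
Proof.
by do 7?split=> *; rewrite /s /j0 ?(inj_eq lift_inj) ?(eq_sym _ i0) ?(eq_sym _ k0)
  ?(negbTE (neq_lift _ _)).
Qed.

Lemma conj_of_heis u : conjP (of_heis u) =
  \sum_t (u.1.1 0 t *: delta_mx i0 (s t) + u.1.2 0 t *: delta_mx (s t) j0)
              + u.2 *: delta_mx i0 j0.
Proof.
rewrite /conjP /of_heis mulmxDr mulmxDl mulmx_sumr mulmx_suml.
congr (_ + _); last by rewrite -scalemxAr -scalemxAl conj_conj_delta.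
apply: eq_bigr => t _; rewrite mulmxDr mulmxDl -!scalemxAr -!scalemxAl.
by rewrite !conj_conj_delta.
Qed.

Lemma to_heisK u : to_heis (of_heis u) = u.
Proof.
rewrite /to_heis !conj_of_heis; case: u => [[x y] c] /=; congr (_, _, _).
- apply/rowP => t; rewrite !mxE summxE (bigD1 t) //= big1 => [|t' /negbTE tt'].
    by rewrite !mxE !heis_index_eq !eqxx ?andbF /=; ring.
  by rewrite !mxE !heis_index_eq [t == _]eq_sym tt' ?andbF /=; ring.
- apply/rowP => t; rewrite !mxE summxE (bigD1 t) //= big1 => [|t' /negbTE tt'].
    by rewrite !mxE !heis_index_eq !eqxx ?andbF /=; ring.
  by rewrite !mxE !heis_index_eq [t == _]eq_sym tt' ?andbF /=; ring.
- rewrite !mxE summxE big1 => [|t _]; first by rewrite !eqxx /=; ring.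
  by rewrite !mxE !heis_index_eq ?andbF /=; ring.
Qed.

Lemma weight_mxDZ c a X Y :
  weight_mx P d c X -> weight_mx P d c Y -> weight_mx P d c (a *: X + Y).
Proof.
move=> wX wY i j; rewrite mulmxDr mulmxDl -scalemxAr -scalemxAl mxE [X in X + _]mxE.
have [-> |/wX //] := eqVneq ((P *m X *m invmx P) i j) 0.
by rewrite mulr0 add0r; exact: wY.
Qed.

Lemma weight_mx0 c : weight_mx P d c 0.
Proof. by move=> i j; rewrite mulmx0 mul0mx mxE eqxx. Qed.

Lemma weight_of_heis_1 u : u.2 = 0 -> weight_mx P d (-1) (of_heis u).
Proof.
move=> u0; rewrite /of_heis u0 scale0r addr0.
elim/big_ind: _ => [|X Y wX wY|t _]; first exact: weight_mx0.
  by rewrite -[X]scale1r; exact: weight_mxDZ.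
apply: weight_mxDZ; first by apply: weight_conj_delta => //; rewrite d_mid; ring.
rewrite -[_ *: conj_delta _ _ _]addr0; apply: weight_mxDZ; last exact: weight_mx0.
by apply: weight_conj_delta => //; rewrite d_mid d_max; ring.
Qed.

Lemma weight_of_heis_2 u : u.1 = 0 -> weight_mx P d (-2) (of_heis u).
Proof.
move=> u0; rewrite /of_heis u0 big1 => [|t _]; last by rewrite !mxE !scale0r addr0.
rewrite add0r -[_ *: conj_delta _ _ _]addr0; apply: weight_mxDZ; last exact: weight_mx0.
by apply: weight_conj_delta => //; rewrite d_max; ring.
Qed.

Section Iso.

Variables n1 n2 : {vspace gl R m.+2}.
Hypothesis n1E : forall X : 'M[R]_m.+2, X \in n1 <-> weight_mx P d (-1) X.
Hypothesis n2E : forall X : 'M[R]_m.+2, X \in n2 <-> weight_mx P d (-2) X.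

Lemma weights_lower (X : 'M[R]_m.+2) a b : X \in (n2 + n1)%VS ->
  conjP X a b != 0 -> d 0 a - d 0 b = -1 \/ d 0 a - d 0 b = -2.
Proof.
move=> /memv_addP[Z /n2E wZ [Y /n1E wY ->]].
have -> : conjP (Z + Y) a b = conjP Z a b + conjP Y a b.
  by rewrite /conjP mulmxDr mulmxDl [LHS]mxE.
have [Z0|/wZ ->] := eqVneq (conjP Z a b) 0; last by right.
by rewrite Z0 add0r => /wY ->; left.
Qed.

(** Of the nine kinds of positions, those not read by [to_heis] have weight neither -1 nor -2, so
    the entries of [X] vanish there. *)
Lemma to_heis_inj (X : 'M[R]_m.+2) : X \in (n2 + n1)%VS -> to_heis X = 0 -> X = 0.
Proof.
move=> XU [/rowP X1 /rowP X2 X3].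
suff Y0 : conjP X = 0.
  have -> : X = invmx P *m conjP X *m P.
    by rewrite /conjP !mulmxA mulVmx // mul1mx mulmxKV.
  by rewrite Y0 mulmx0 mul0mx.
have zero a b : ~ (d 0 a - d 0 b = -1 \/ d 0 a - d 0 b = -2) -> conjP X a b = 0.
  by move=> nd; apply/eqP; apply: contraT => /(weights_lower XU)/nd.
apply/matrixP; apply: heis_index => [||t]; apply: heis_index => [||t']; rewrite [RHS]mxE.
- by apply: zero => -[]; lra.
- exact: X3.
- by have := X1 t'; rewrite mxE [RHS]mxE.
- by apply: zero; rewrite d_max => -[]; lra.
- by apply: zero => -[]; lra.
- by apply: zero; rewrite d_max d_mid => -[]; lra.
- by apply: zero; rewrite d_mid => -[]; lra.
- by have := X2 t; rewrite mxE [RHS]mxE.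
- by apply: zero; rewrite !d_mid => -[]; lra.
Qed.

Lemma to_heis_1 (X : 'M[R]_m.+2) : X \in n1 -> (to_heis X).2 = 0.
Proof.
move=> /n1E wX; apply/eqP; apply: contraT => /wX; rewrite d_max; lra.
Qed.

Lemma to_heis_2 (X : 'M[R]_m.+2) : X \in n2 -> (to_heis X).1 = 0.
Proof.
move=> /n2E wX; congr (_, _); apply/rowP => t; rewrite [LHS]mxE [RHS]mxE;
  by apply/eqP; apply: contraT => /wX; rewrite ?d_max d_mid; lra.
Qed.

(** A product of two negative matrices has weights at most -2, so only its corner survives, and this
    is a dot product over the middle indices. *)
Lemma to_heis_lie (X Y : 'M[R]_m.+2) : X \in (n2 + n1)%VS -> Y \in (n2 + n1)%VS ->
  to_heis (gl_lie X Y) = heis_lie (to_heis X) (to_heis Y).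
Proof.
move=> XU YU; pose A := conjP X; pose B := conjP Y.
have AB : conjP (gl_lie X Y) = A *m B - B *m A.
  rewrite /A /B /conjP /gl_lie mulmxBr mulmxBl.
  by rewrite !mulmxA !(mulmxKV Pu).
have drop (Z W : 'M[R]_m.+2) a b : Z \in (n2 + n1)%VS -> W \in (n2 + n1)%VS ->
    -1 <= d 0 a - d 0 b -> (conjP Z *m conjP W) a b = 0.
  move=> ZU WU ab; rewrite mxE big1 // => c _.
  have [-> |/(weights_lower ZU) h] := eqVneq (conjP Z a c) 0; first by rewrite mul0r.
  have [-> |/(weights_lower WU) h'] := eqVneq (conjP W c b) 0; first by rewrite mulr0.
  by case: h => h; case: h' => h'; lra.
have corner (Z W : 'M[R]_m.+2) : Z \in (n2 + n1)%VS -> W \in (n2 + n1)%VS ->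
    (conjP Z *m conjP W) i0 j0
    = ((to_heis Z).1.1 *m (to_heis W).1.2^T) 0 0.
  (* The terms of the middle index [i0] or [j0] contain a diagonal entry, of weight 0, and
     vanish. *)
  move=> ZU WU; rewrite mxE (bigD1_ord i0) //= (bigD1_ord k0) //= [RHS]mxE.
  have -> : conjP Z i0 i0 = 0.
    by apply/eqP; apply: contraT => /(weights_lower ZU) []; lra.
  have -> : conjP W (lift i0 k0) j0 = 0.
    by apply/eqP; apply: contraT => /(weights_lower WU) []; lra.
  rewrite mul0r mulr0 !add0r; apply: eq_bigr => t _.
  by rewrite [in RHS]mxE [X in _ = _ * X]mxE [X in _ = _ * X]mxE.
rewrite /to_heis /heis_lie AB; congr (_, _, _).
- apply/rowP => t; rewrite [LHS]mxE [LHS]mxE [X in _ + X]mxE !drop ?d_mid //; try lra.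
  by rewrite subrr mxE.
- apply/rowP => t; rewrite [LHS]mxE [LHS]mxE [X in _ + X]mxE !drop ?d_mid ?d_max //; try lra.
  by rewrite subrr mxE.
- rewrite [LHS]mxE [X in _ + X]mxE !corner //; congr (_ - _).
  by rewrite mxE [RHS]mxE; apply: eq_bigr => t _; rewrite mulrC !mxE.
Qed.

Lemma weights_graded_iso : graded_iso n1 n2 (heis_1 R m) (heis_2 R m).
Proof.
pose f : 'Hom(gl R m.+2, heis R m) := linfun to_heis.
have fE X : f X = to_heis X by rewrite lfunE.
exists f; split.
- move=> X Y XU YU fXY; apply: subr0_eq; apply: to_heis_inj; first exact: memvB.
  by rewrite -fE linearB /= fXY subrr.
- apply/vspaceP => u; apply/memv_imgP/idP => [[X X1 ->]|].
    by rewrite fE mem_heis_1; apply/eqP; exact: to_heis_1.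
  rewrite mem_heis_1 => /eqP u0; exists (of_heis u); last by rewrite fE to_heisK.
  by apply/n1E; exact: weight_of_heis_1.
- apply/vspaceP => u; apply/memv_imgP/idP => [[X X2 ->]|].
    by rewrite fE mem_heis_2; apply/eqP; exact: to_heis_2.
  rewrite mem_heis_2 => /eqP u0; exists (of_heis u); last by rewrite fE to_heisK.
  by apply/n2E; exact: weight_of_heis_2.
- by move=> X Y XU YU; rewrite !fE; exact: to_heis_lie.
Qed.

End Iso.

End WeightsToHeisenberg.

(** * From the Heisenberg algebra to an H-type scalar product *)

Section HeisenbergToHType.

Variables (R : realType) (m : nat).
Implicit Types (c : R) (u v w : heis_space R m).

Definition heis_dot u v : R :=
  (u.1.1 *m v.1.1^T) 0 0 + (u.1.2 *m v.1.2^T) 0 0 + u.2 * v.2.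

Lemma heis_dotDZl c u v w : heis_dot (c *: u + v) w = c * heis_dot u w + heis_dot v w.
Proof.
by rewrite /heis_dot /= !mulmxDl -!scalemxAl !mxE /GRing.scale /=; ring.
Qed.

Lemma mulmx_trC (x y : 'rV[R]_m) : (x *m y^T) 0 0 = (y *m x^T) 0 0.
Proof. by rewrite mxE [RHS]mxE; apply: eq_bigr => t _; rewrite mulrC !mxE. Qed.

Lemma heis_dotC u v : heis_dot u v = heis_dot v u.
Proof. by rewrite /heis_dot mulmx_trC (mulmx_trC u.1.2) mulrC. Qed.

Lemma mulmx_tr_ge0 (x : 'rV[R]_m) : 0 <= (x *m x^T) 0 0.
Proof. by rewrite mxE sumr_ge0 // => t _; rewrite !mxE sqr_ge0. Qed.

Lemma mulmx_tr_eq0 (x : 'rV[R]_m) : (x *m x^T) 0 0 = 0 -> x = 0.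
Proof.
rewrite mxE => /eqP; rewrite psumr_eq0 => [/allP x0|t _]; last by rewrite !mxE sqr_ge0.
apply/rowP => t; have := x0 t (mem_index_enum t).
by rewrite /= !mxE mulf_eq0 orbb => /eqP.
Qed.

Lemma heis_dot_gt0 u : u != 0 -> 0 < heis_dot u u.
Proof.
have x0 := mulmx_tr_ge0 u.1.1; have y0 := mulmx_tr_ge0 u.1.2.
have z0 : 0 <= u.2 * u.2 by apply: sqr_ge0.
rewrite lt0r /heis_dot !addr_ge0 // andbT; apply: contraNN.
rewrite !paddr_eq0 ?addr_ge0 // => /andP[/andP[/eqP x /eqP y]].
case: u {x0 y0 z0} x y => [[x y] z] /= /mulmx_tr_eq0 -> /mulmx_tr_eq0 ->.
by rewrite mulf_eq0 orbb => /eqP ->.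
Qed.

(** The standard complex structure [(x, y) |-> (-y, x)] scaled by the central coordinate [c] of [z];
    this is the map [J_z] for [heis_dot]. *)
Definition heis_J c u : heis_space R m := (c *: (- u.1.2), c *: u.1.1, 0).

Lemma heis_J_linear c : linear (heis_J c).
Proof.
move=> a u v; congr (_, _, _) => /=; last by rewrite scaler0 addr0.
  by rewrite opprD scalerDr -!scalerN !scalerA mulrC.
by rewrite scalerDr !scalerA mulrC.
Qed.

HB.instance Definition _ c :=
  GRing.isLinear.Build R (heis_space R m) (heis_space R m) _ (heis_J c) (heis_J_linear c).

Lemma heis_J_dot c u v z : z.1 = 0 -> u.2 = 0 -> z.2 = c ->
  heis_dot (heis_J c u) v = heis_dot (heis_lie u v) z.
Proof.
case: z => _ z /= -> u0 ->; rewrite /heis_dot /= -!scalemxAl mulNmx !mul0mx !mxE; ring.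
Qed.

Lemma heis_J_sqr c u : u.2 = 0 -> heis_J c (heis_J c u) = - (c * c) *: u.
Proof.
case: u => [[x y] _] /= ->; congr (_, _, _); rewrite /= ?scaler0 //.
  by rewrite scalerN scalerA scaleNr.
by rewrite scalerN scalerN scalerA scaleNr.
Qed.

Variables (L : lieAlg R) (n1 n2 : {vspace L}).

(** Pull back [heis_dot] and [heis_J] along the isomorphism. Positivity of [m] provides a nonzero
    bracket, as [graded_2step] demands. *)
Lemma heis_iso_H_type : (0 < m)%N ->
  graded_iso n1 n2 (heis_1 R m) (heis_2 R m) ->
  (forall x y : L, x \in n1 -> y \in n1 -> lie x y \in n2) ->
  (forall x z : L, x \in (n2 + n1)%VS -> z \in n2 -> lie x z = 0) ->
  exists ip, H_type n1 n2 ip.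
Proof.
move=> m0 [f [f_inj f1 f2 f_lie]] br11 br2.
have f0 x : x \in (n2 + n1)%VS -> f x = 0 -> x = 0.
  by move=> xU fx; apply: f_inj; rewrite ?mem0v ?linear0.
have f1E x : x \in n1 -> (f x : heis_space R m).2 = 0.
  by move=> x1; apply/eqP; rewrite -mem_heis_1 -f1 memv_img.
have f2E x : x \in n2 -> (f x : heis_space R m).1 = 0.
  by move=> x2; apply/eqP; rewrite -mem_heis_2 -f2 memv_img.
have m1 x : x \in n1 -> x \in (n2 + n1)%VS by apply/subvP/addvSr.
have m2 x : x \in n2 -> x \in (n2 + n1)%VS by apply/subvP/addvSl.
exists (fun x y => heis_dot (f x) (f y)); split.
- split=> //.
  + apply/directv_addP/eqP; rewrite -subv0; apply/subvP => x.
    rewrite memv_cap memv0 => /andP[x2 x1]; apply/eqP/f0; first exact: m1.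
    by case: (f x) (f1E _ x1) (f2E _ x2) => a b /= -> ->.
  + pose e : 'rV[R]_m := delta_mx 0 (Ordinal m0).
    have lift1 (u : heis R m) : (u : heis_space R m).2 = 0 -> exists2 x, x \in n1 & u = f x.
      by move=> /eqP; rewrite -mem_heis_1 -f1 => /memv_imgP.
    have [x x1 fx] := lift1 (e, 0, 0) erefl; have [y y1 fy] := lift1 (0, e, 0) erefl.
    exists x, y; split=> //; apply/eqP => /(congr1 f).
    rewrite f_lie ?m1 // -fx -fy linear0 => -[] /eqP.
    by rewrite trmx0 mulmx0 trmx_delta mul_delta_mx !mxE !eqxx subr0 oner_eq0.
- split.
  + by move=> a x y z _ _ _; rewrite linearP heis_dotDZl.
  + by move=> x y _ _; exact: heis_dotC.
  + by move=> x xU x0; apply: heis_dot_gt0; apply: contraNneq x0 => /(f0 _ xU) ->.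
- move=> z x /f2E z1 /f1E x2; rewrite /heis_dot z1 x2 /= !mul0mx mulr0 !mxE.
  by rewrite !addr0.
pose U := (n2 + n1)%VS.
(* The map [f] is injective only on [U], so an inverse on the image of [U] is built from the
   pseudo-inverse of [f] precomposed with the projection. *)
pose h := (projv U \o (f \o projv U)^-1)%VF.
have hK x : x \in n1 -> h (f x) = x.
  move=> x1; have xU := m1 _ x1.
  have : (f \o projv U)%VF (((f \o projv U)^-1)%VF (f x)) = f x.
    apply: limg_lfunVK; apply/memv_imgP; exists x; first exact: memvf.
    by rewrite lfunE /= projv_id.
  rewrite lfunE /= /h lfunE /= => /f_inj -> //; exact: memv_proj.
pose J z : 'End(L) := (h \o (linfun (heis_J (f z : heis_space R m).2) \o f))%VF.
have JE z x : x \in n1 -> exists2 y, y \in n1 &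
    J z x = y /\ f y = heis_J (f z : heis_space R m).2 (f x).
  move=> x1; have : (heis_J (f z : heis_space R m).2 (f x) : heis R m) \in heis_1 R m.
    by rewrite mem_heis_1.
  rewrite -f1 => /memv_imgP[y y1 fy]; exists y => //; split=> //.
  have -> : J z x = h (heis_J (f z : heis_space R m).2 (f x)).
    by rewrite /J [LHS]comp_lfunE; congr (h _); rewrite [LHS]comp_lfunE; exact: lfunE.
  by rewrite fy hK.
exists J => z z2; split.
- apply/subvP => _ /memv_imgP[x x1 ->].
  by have [y y1 [-> _]] := JE z x x1.
- move=> x y x1 y1; have [w w1 [-> ->]] := JE z x x1.
  rewrite f_lie ?m1 //; apply: heis_J_dot => //; [exact: f2E|exact: f1E].
- move=> x x1; have [y y1 [Jx fy]] := JE z x x1; rewrite Jx.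
  have [w w1 [-> fw]] := JE z y y1; apply: f_inj; rewrite ?memvZ ?m1 //.
  rewrite fw fy heis_J_sqr; [rewrite linearZ|exact: f1E]; rewrite /=; congr (- _ *: _).
  by rewrite /heis_dot f2E //= !mul0mx !mxE !add0r.
Qed.

End HeisenbergToHType.

(** * The grading with block sizes 1, n - 1, 1 *)

Section ContactGrading.

Variables (R : realType) (m : nat) (i0 : 'I_m.+2) (k0 : 'I_m.+1).
Let j0 := lift i0 k0.
Implicit Types X Y : 'M[R]_m.+2.

(** The level of an index: 0 at [i0], 2 at [j0] and 1 elsewhere. The elementary matrix at [(a, b)]
    gets degree [w a - w b]. *)
Definition block_degree (a : 'I_m.+2) : int := ((a != i0) + (a == j0))%N.
Local Notation w := block_degree.

Lemma block_degree_diff a b : `|w a - w b| <= 2.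
Proof. by rewrite /w; do 4!case: eqP. Qed.

Definition degree_part (k : int) X : 'M[R]_m.+2 :=
  \matrix_(a, b) if w a - w b == k then X a b else 0.

Lemma degree_part_linear k : linear (degree_part k).
Proof.
move=> c X Y; apply/matrixP => a b; rewrite !mxE.
by case: ifP => _ //; rewrite mulr0 addr0.
Qed.

HB.instance Definition _ k :=
  GRing.isLinear.Build R 'M[R]_m.+2 'M[R]_m.+2 _ (degree_part k) (degree_part_linear k).

(** Traceless matrices fixed by the projection [degree_part k], written as a kernel to obtain a
    subspace. *)
Definition contact_grading (k : int) : {vspace gl R m.+2} :=
  (sl R m.+2 :&: lker (linfun (degree_part k) - \1%VF))%VS.

Lemma mem_contact_grading k X : X \in contact_grading k <->
  \tr X = 0 /\ forall a b, X a b != 0 -> w a - w b = k.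
Proof.
rewrite memv_cap mem_sl memv_ker add_lfunE opp_lfunE id_lfunE lfunE /= subr_eq0.
split=> [/andP[/eqP-> /eqP/matrixP Xk]|[-> Xk]]; last first.
  rewrite eqxx; apply/eqP/matrixP => a b; rewrite mxE; case: ifPn => // ab.
  by symmetry; apply: contraNeq ab => /Xk ->.
split=> // a b; rewrite -Xk mxE; case: ifPn => [/eqP //|]; by rewrite eqxx.
Qed.

Lemma contact_delta a b : a != b ->
  (delta_mx a b : 'M[R]_m.+2) \in contact_grading (w a - w b).
Proof.
move=> ab; apply/mem_contact_grading; split.
  rewrite /mxtrace big1 // => i _; rewrite mxE.
  by case: eqP => [->|//]; rewrite (negbTE ab).
by move=> i j; rewrite mxE pnatr_eq0 eqb0 negbK => /andP[/eqP-> /eqP->].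
Qed.

(** A middle index [s] exists because [m] is positive; it makes the corner matrix a bracket of two
    matrices of degree -1, whence generation. *)
Lemma contact_two_grading : (0 < m)%N -> two_grading (sl R m.+2) contact_grading.
Proof.
move=> m0; pose s := lift i0 (lift k0 (Ordinal m0)).
have i0s : i0 != s by rewrite neq_lift.
have i0j0 : i0 != j0 by rewrite neq_lift.
have sj0 : s != j0 by rewrite (inj_eq lift_inj) eq_sym neq_lift.
have wi : w i0 = 0 by rewrite /w eqxx (negbTE i0j0).
have wj : w j0 = 2 by rewrite /w eqxx eq_sym i0j0.
have ws : w s = 1 by rewrite /w eq_sym i0s (negbTE sj0).
split.
- split.
    apply/directv_sum_independent => u ug u0 k _; apply/matrixP => a b; rewrite [RHS]mxE.
    have [//|kab] := eqVneq (u k a b) 0.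
    have uk := ((mem_contact_grading _ _).1 (ug k isT)).2 _ _ kab.
    have /matrixP/(_ a b) := u0; rewrite summxE (bigD1 k) //= big1 => [|l lk].
      by rewrite addr0 [RHS]mxE.
    apply/eqP; apply: contraNT lk => /(((mem_contact_grading _ _).1 (ug l isT)).2).
    rewrite uk => /addIr [] lk; apply/eqP/val_inj; exact: (esym lk).
  apply/eqP; rewrite eqEsubv; apply/andP; split.
    by apply/subv_sumP => k _; exact: capvSl.
  apply/subvP => X; rewrite mem_sl => /eqP trX.
  apply/memv_sumP; exists (fun k : 'I_5 => degree_part (k%:Z - 2) X).
    move=> k _; apply/mem_contact_grading; split=> [|a b]; last first.
      by rewrite mxE; case: ifPn => [/eqP|]; rewrite ?eqxx.
    (* The diagonal lies entirely in degree 0, so the trace of a component is either that of [X] or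
       zero. *)
    have [k2|k2] := eqVneq (k%:Z - 2) 0.
      by rewrite -[RHS]trX; apply: eq_bigr => a _; rewrite mxE subrr k2 eqxx.
    by rewrite /mxtrace big1 // => a _; rewrite mxE subrr eq_sym (negbTE k2).
  apply/matrixP => a b; rewrite summxE.
  have [l lab] := grade_onto (block_degree_diff a b).
  rewrite (bigD1 l) //= mxE -lab eqxx big1 ?addr0 // => k kl.
  rewrite mxE -lab; case: eqP => // /addIr [] kl'.
  by rewrite (val_inj kl') eqxx in kl.
- move=> k k2; apply/eqP; rewrite -subv0; apply/subvP => X.
  move=> /mem_contact_grading[_ Xk]; rewrite memv0; apply/eqP/matrixP => a b.
  rewrite [RHS]mxE; apply/eqP; apply: contraT => /Xk abk.
  by have := block_degree_diff a b; rewrite abk leNgt k2.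
- move=> i j X Y /mem_contact_grading[_ Xi] /mem_contact_grading[_ Yj].
  have mul (Z W : 'M[R]_m.+2) k l a b :
      (forall a b, Z a b != 0 -> w a - w b = k) ->
      (forall a b, W a b != 0 -> w a - w b = l) ->
      (Z *m W) a b != 0 -> w a - w b = k + l.
    move=> Zk Wl ab; have [c] : exists c, Z a c * W c b != 0.
      apply/existsP; apply: contraNT ab; rewrite negb_exists => /forallP h.
      by rewrite mxE big1 // => c _; apply/eqP; have := h c; rewrite negbK.
    by rewrite mulf_eq0 negb_or => /andP[/Zk <- /Wl <-]; ring.
  apply/mem_contact_grading; split.
    by rewrite /= /gl_lie linearB /= mxtrace_mulC subrr.
  move=> a b; rewrite /= /gl_lie mxE [X in _ + X]mxE.
  have [-> |/(mul _ _ _ _ _ _ Xi Yj) //] := eqVneq ((X *m Y) a b) 0.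
  rewrite add0r oppr_eq0 => /(mul _ _ _ _ _ _ Yj Xi) ->; exact: addrC.
- move=> H Hc H1; rewrite subv_add H1 andbT; apply/subvP => X.
  move=> /mem_contact_grading[_ X2].
  (* Degree -2 occurs only at the corner [(i0, j0)]. *)
  have -> : X = X i0 j0 *: gl_lie (delta_mx i0 s) (delta_mx s j0).
    rewrite /gl_lie mul_delta_mx mul_delta_mx_0 1?eq_sym // subr0.
    apply/matrixP => a b; rewrite !mxE.
    case: (eqVneq (X a b) 0) => [X0|/X2 ab].
      have [ai|] := eqVneq a i0; last by rewrite mulr0.
      have [bj|] := eqVneq b j0; last by rewrite mulr0.
      by rewrite -ai -bj X0 mul0r.
    have [-> ->] : a = i0 /\ b = j0.
      by move: ab; rewrite /w; do 4!case: eqP.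
    by rewrite !eqxx mulr1.
  apply: memvZ; apply: Hc; apply: (subvP H1).
    by have := contact_delta i0s; rewrite wi ws.
  by have := contact_delta sj0; rewrite wj ws.
- apply/eqP => g2; have := contact_delta i0j0.
  rewrite wi wj sub0r g2 memv0 => /eqP/matrixP/(_ i0 j0)/eqP.
  by rewrite !mxE !eqxx oner_eq0.
Qed.

Lemma contact_graded_iso :
  graded_iso (contact_grading (-1)) (contact_grading (-2)) (heis_1 R m) (heis_2 R m).
Proof.
pose d : 'rV[R]_m.+2 := \row_a (w a)%:~R.
have i0j0 : i0 != j0 by rewrite neq_lift.
(* In nonzero degree the diagonal vanishes, so the trace condition is automatic and the weight
   description with [P = 1] applies. *)
have gE k X : k != 0 -> X \in contact_grading k <-> weight_mx 1%:M d k%:~R X.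
  move=> k0'; rewrite /weight_mx invmx1 mul1mx mulmx1.
  split=> [/mem_contact_grading[_ Xk] a b /Xk <-|Xk].
    by rewrite !mxE rmorphB.
  have Xk' a b : X a b != 0 -> w a - w b = k.
    by move=> /Xk; rewrite !mxE -rmorphB => /intr_inj.
  apply/mem_contact_grading; split=> //; apply: big1 => a _.
  by apply/eqP; apply: contraNT k0' => /Xk' <-; rewrite subrr.
apply: (@weights_graded_iso R m 1%:M d i0 k0).
- exact: unitmx1.
- by rewrite !mxE /w !eqxx (negbTE i0j0) eq_sym i0j0 add0r.
- move=> t; rewrite !mxE /w !eqxx (negbTE i0j0) eq_sym neq_lift add0r.
  by rewrite (inj_eq lift_inj) eq_sym (negbTE (neq_lift _ _)).
- by move=> X; rewrite gE.
- by move=> X; rewrite gE.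
Qed.

End ContactGrading.

(** * Brackets in the negative part of a |2|-grading *)

Section NegativePart.

Variables (K : fieldType) (L : lieAlg K) (S : {vspace L}) (g : int -> {vspace L}).
Hypothesis gg : two_grading S g.

Lemma two_grading_lie11 (x y : L) : x \in g (-1) -> y \in g (-1) -> lie x y \in g (-2).
Proof. by case: gg => _ _ glie _ _; exact: glie. Qed.

(** The brackets fall in degrees -4 and -3, where the grading is zero. *)
Lemma two_grading_center (x z : L) :
  x \in (g (-2) + g (-1))%VS -> z \in g (-2) -> lie x z = 0.
Proof.
move=> /memv_addP[t t2 [y y1 ->]] z2; case: gg => _ g0 glie _ _.
have tz := glie _ _ _ _ t2 z2; have yz := glie _ _ _ _ y1 z2.
rewrite (g0 (-2 + -2)) // memv0 in tz; rewrite (g0 (-1 + -2)) // memv0 in yz.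
by rewrite -[t]scale1r lieDZl (eqP tz) (eqP yz) scaler0 addr0.
Qed.

End NegativePart.

(** * Characterization and existence of H-type negative parts *)

Unset Implicit Arguments.

Theorem theorem9 (R : realType) (n : nat) (hn : (2 <= n)%N) :
  (forall g : int -> {vspace gl R n.+1}, two_grading (sl R n.+1) g ->
     (exists ip, H_type (g (-1)) (g (-2)) ip) <->
     heisenberg_of_dim (g (-1)) (g (-2)) (2 * n - 1)%N) /\
  (exists g : int -> {vspace gl R n.+1}, two_grading (sl R n.+1) g /\
     exists ip, H_type (g (-1)) (g (-2)) ip).
Proof.
case: n hn => // m m0; rewrite ltnS in m0; split=> [g gg|]; last first.
  exists (contact_grading R ord0 ord0); split; first exact: contact_two_grading.
  apply: (heis_iso_H_type m0 (contact_graded_iso _ _ _)).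
    exact: (two_grading_lie11 (contact_two_grading _ _ _ m0)).
  exact: (two_grading_center (contact_two_grading _ _ _ m0)).
split=> [[ip Hip]|[m' [dim_m' iso]]]; last first.
  apply: (heis_iso_H_type _ iso).
  (* With [n = m + 1] the dimension [2 * n - 1] equals [2 * m + 1], so [m' = m] is positive. *)
  - by move: dim_m'; rewrite dim_heis; lia.
  - exact: (two_grading_lie11 gg).
  - exact: (two_grading_center gg).
exists m; split; first by rewrite dim_heis; lia.
have [P Pu [d [dg dE]]] := two_grading_weights gg.
have g1E X : X \in g (-1) <-> weight_mx P d (-1) X by apply: dE.
have g2E X : X \in g (-2) <-> weight_mx P d (-2) X by apply: dE.
have [i0 [j0 [dj ds]]] := H_type_weights Pu dg g1E g2E Hip.
(* The two extreme indices have different weights, so [j0] can be written as [lift i0 k0], the form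
   used by [weights_graded_iso]. *)
have : i0 != j0 by apply/eqP => ij; move: dj; rewrite ij; lra.
move=> /unlift_some[k0 jk _]; rewrite jk in dj ds.
apply: (weights_graded_iso (k0 := k0) Pu dj) => // t.
by apply: ds; rewrite ?(inj_eq lift_inj) eq_sym neq_lift.
Qed.
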